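(* Let $\lambda$ be a nonzero complex number. Then $C_{0,\lambda}=1$, and for every integer $n\geq 1$, $$\sum_{m=1}^n \sum_{k=1}^m \binom{n}{m} C_{n-m,\lambda}\,(k-1)!\,(-1)^{k-1}\lambda^{m-k}\, S_1(m,k)= \begin{cases} 1, & \text{if } n=1,\\ 0, & \text{if } n>1,\end{cases}$$ where $C_{n,\lambda}$ are the degenerate Cauchy numbers of the second kind and $S_1(m,k)$ are the (signed) Stirling numbers of the first kind.
   Context: All generating functions are formal power series in $t$, with $\log(1+u)=\sum_{k\ge 1}\frac{(-1)^{k-1}}{k}u^k$. The degenerate Cauchy numbers of the second kind $C_{n,\lambda}$ are defined by $$\frac{t}{\log\left(1+\frac{1}{\lambda}\log(1+\lambda t)\right)}=\sum_{n=0}^\infty C_{n,\lambda}\frac{t^n}{n!}.$$ The Stirling numbers of the first kind $S_1(n,l)$ are defined by $(x)_n=\sum_{l=0}^n S_1(n,l)x^l$ for $n\ge 0$, where $(x)_0=1$ and $(x)_n=x(x-1)\cdots(x-n+1)$ for $n\geq 1$. *)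

(* Defs.v *)
From HB Require Import structures.
From mathcomp Require Import all_boot all_order all_algebra.
From mathcomp Require Import reals complex.
Set Implicit Arguments.
Unset Strict Implicit.
Unset Printing Implicit Defensive.
Import GRing.Theory.
Local Open Scope ring_scope.

Section FormalPowerSeries.
Variable K : fieldType.

(* f : fps is the series \sum_n f n * t^n *)
Definition fps := nat -> K.

Implicit Types f g u : fps.

Definition fps1 : fps := fun n => (n == 0%N)%:R.

Definition fpsX : fps := fun n => (n == 1%N)%:R.

Definition fps_scale (c : K) f : fps := fun n => c * f n.

Definition fps_mul f g : fps := fun n => \sum_(i < n.+1) f i * g (n - i)%N.

Definition fps_exp f (k : nat) : fps := iter k (fps_mul f) fps1.

(* log (1 + u) = \sum_(k >= 1) (-1)^(k-1) / k * u^k, for u 0 = 0; the terms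
   with k > n do not contribute to the coefficient of t^n. *)
Definition fps_log1p u : fps := fun n =>
  \sum_(1 <= k < n.+1) (-1) ^+ k.-1 / k%:R * fps_exp u k n.

(* The first n coefficients of 1 / f, for f 0 != 0, obtained by solving
   f * g = 1 for the coefficients of g successively. *)
Fixpoint fps_inv_seq f (n : nat) : seq K :=
  if n is n'.+1 then
    let s := fps_inv_seq f n' in
    rcons s ((f 0%N)^-1 * ((n' == 0%N)%:R - \sum_(i < n') s`_i * f (n' - i)%N))
  else [::].

Definition fps_inv f : fps := fun n => (fps_inv_seq f n.+1)`_n.

(* t / f, for f 0 = 0 and f 1 != 0, i.e. the inverse of the series f / t *)
Definition fpsX_div f : fps := fps_inv (fun n => f n.+1).

Lemma size_fps_inv_seq f n : size (fps_inv_seq f n) = n.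
Proof. by elim: n => //= n IHn; rewrite size_rcons IHn. Qed.

Lemma nth_fps_inv_seq f n i : (i < n)%N -> (fps_inv_seq f n)`_i = fps_inv f i.
Proof.
elim: n => // n IHn; rewrite ltnS leq_eqVlt => /orP[/eqP -> //|lt_in].
by rewrite /= nth_rcons size_fps_inv_seq lt_in IHn.
Qed.

Lemma fps_mulVf f : f 0%N != 0 -> fps_mul (fps_inv f) f =1 fps1.
Proof.
move=> f0 n; rewrite /fps_mul big_ord_recr /= subnn.
rewrite {2}/fps_inv /= nth_rcons size_fps_inv_seq ltnn eqxx.
rewrite mulrAC mulVf // mul1r.
have -> : \sum_(i < n) (fps_inv_seq f n)`_i * f (n - i)%N =
          \sum_(i < n) fps_inv f i * f (n - i)%N.
  by apply: eq_bigr => i _; rewrite nth_fps_inv_seq.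
by rewrite addrC subrK.
Qed.

Lemma fps_mul_X_div f :
  f 0%N = 0 -> f 1%N != 0 -> fps_mul (fpsX_div f) f =1 fpsX.
Proof.
move=> f0 f1 [|n]; first by rewrite /fps_mul big_ord1 f0 mulr0.
rewrite /fps_mul big_ord_recr /= subnn f0 mulr0 addr0.
rewrite /fpsX eqSS -[RHS](@fps_mulVf (fun n => f n.+1) f1 n).
by apply: eq_bigr => i _; rewrite subSn // -ltnS.
Qed.

(* C_(n, lambda) is n! times the coefficient of t^n. *)
Definition cauchy2_gf (lambda : K) : fps :=
  fpsX_div
    (fps_log1p (fps_scale lambda^-1 (fps_log1p (fps_scale lambda fpsX)))).

Definition cauchy2 (lambda : K) (n : nat) : K := n`!%:R * cauchy2_gf lambda n.

(* Nondegeneracy of the denominator: t / log (1 + ...) is a genuine quotient. *)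
Lemma cauchy2_gfP (lambda : K) : lambda != 0 ->
  fps_mul (cauchy2_gf lambda)
    (fps_log1p (fps_scale lambda^-1 (fps_log1p (fps_scale lambda fpsX))))
  =1 fpsX.
Proof.
move=> l0; apply: fps_mul_X_div; first by rewrite /fps_log1p big_geq.
have log1 u : fps_log1p u 1%N = u 1%N.
  rewrite /fps_log1p big_nat1 expr0 divr1 mul1r /fps_exp /= /fps_mul.
  by rewrite !big_ord_recl big_ord0 /fps1 /= mulr0 mulr1 add0r addr0.
by rewrite log1 /fps_scale log1 /fpsX eqxx mulr1 mulVf // oner_neq0.
Qed.

End FormalPowerSeries.

(* (x)_n = x (x - 1) ... (x - n + 1) as a polynomial in x *)
Definition falling_poly (n : nat) : {poly int} := \prod_(i < n) ('X - i%:R%:P).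

Definition stirling1 (n l : nat) : int := (falling_poly n)`_l.

(* Main.v *)
(** Put [L = log (1 + lambda t)].  The operator [T = (1 + lambda t) d/dt] is a
    derivation with [T L = lambda], so [T (L^k) = k lambda L^(k-1)].  Comparing
    coefficients, [m! [t^m] L^k / (k! lambda^m)] obeys the recurrence
    [S_1(m+1, k) = S_1(m, k-1) - m S_1(m, k)] of the Stirling numbers, whence
    [m! [t^m] L^k = k! lambda^m S_1(m, k)].  The double sum is then [n!] times
    the coefficient of [t^n] in the product of [t / log (1 + L / lambda)] and
    [log (1 + L / lambda)]. *)
Require Import Defs.
From HB Require Import structures.
From mathcomp Require Import all_boot all_order all_algebra.
From mathcomp Require Import reals complex.
From mathcomp Require Import ring.
Set Implicit Arguments.
Unset Strict Implicit.
Unset Printing Implicit Defensive.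
Import GRing.Theory.
Local Open Scope ring_scope.

Lemma stirling10 k : stirling1 0 k = (k == 0%N)%:R.
Proof. by rewrite /stirling1 /falling_poly big_ord0 coef1. Qed.

(** The last factor of [falling_poly m.+1] is ['X - m]; its ['X] part shifts the index down and so
    contributes nothing at [k = 0]. *)
Lemma stirling1S m k :
  stirling1 m.+1 k =
  (if k is k'.+1 then stirling1 m k' else 0) - stirling1 m k * m%:R.
Proof.
rewrite /stirling1 /falling_poly big_ord_recr /= mulrBr coefB coefMX coefMC.
by case: k.
Qed.

Section FpsDerivation.
Variables (K : fieldType) (lambda : K).
Implicit Types f g : fps K.

Lemma eq_fps_mul f f' g g' :
  f =1 f' -> g =1 g' -> fps_mul f g =1 fps_mul f' g'.
Proof. by move=> ff' gg' n; apply: eq_bigr => i _; rewrite ff' gg'. Qed.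

Lemma fps_mul1 f : fps_mul (@fps1 K) f =1 f.
Proof.
move=> n; rewrite /fps_mul big_ord_recl subn0 mul1r big1 ?addr0 // => i _.
by rewrite /fps1 mul0r.
Qed.

Lemma fps_mulZl c f g : fps_mul (fps_scale c f) g =1 fps_scale c (fps_mul f g).
Proof.
by move=> n; rewrite /fps_scale /fps_mul mulr_sumr; apply: eq_bigr => i _; ring.
Qed.

Lemma fps_mulZr c f g : fps_mul f (fps_scale c g) =1 fps_scale c (fps_mul f g).
Proof.
by move=> n; rewrite /fps_scale /fps_mul mulr_sumr; apply: eq_bigr => i _; ring.
Qed.

Lemma fps_expZ c f k :
  fps_exp (fps_scale c f) k =1 fps_scale (c ^+ k) (fps_exp f k).
Proof.
elim: k => [|k IHk] n; first by rewrite /fps_scale mul1r.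
rewrite /fps_exp !iterS -!/(fps_exp _ _) (eq_fps_mul (frefl _) IHk).
by rewrite fps_mulZl /fps_scale fps_mulZr /fps_scale mulrA -exprS.
Qed.

Lemma fps_expX k n : fps_exp (@fpsX K) k n = (n == k)%:R.
Proof.
elim: k n => [|k IHk] n //.
rewrite /fps_exp iterS -/(fps_exp _ _) /fps_mul.
case: n => [|n]; first by rewrite big_ord1 /fpsX mul0r.
rewrite big_ord_recl mul0r add0r big_ord_recl /= big1 => [|i _].
  by rewrite IHk mul1r addr0 subn1.
by rewrite mul0r.
Qed.

Lemma fps_exp_coef0 f k : f 0%N = 0 -> fps_exp f k 0%N = (k == 0%N)%:R.
Proof.
move=> f0; case: k => [|k] //.
by rewrite /fps_exp iterS /fps_mul big_ord1 f0 mul0r.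
Qed.

Lemma fps_log1p_coef0 f : fps_log1p f 0%N = 0.
Proof. by rewrite /fps_log1p big_geq. Qed.

(* The derivation (1 + lambda t) d/dt. *)
Definition fps_twderiv f : fps K :=
  fun n => n.+1%:R * f n.+1 + lambda * (n%:R * f n).

(** Leibniz rule. Both [d/dt] and [t d/dt] weight a coefficient by its degree, and in a Cauchy
    product this weight splits as [i] plus its complement. *)
Lemma fps_twderivM f g n :
  fps_twderiv (fps_mul f g) n =
  fps_mul (fps_twderiv f) g n + fps_mul f (fps_twderiv g) n.
Proof.
have derivM : n.+1%:R * fps_mul f g n.+1 =
    \sum_(i < n.+1) i.+1%:R * f i.+1 * g (n - i)%N +
    \sum_(i < n.+1) f i * ((n - i).+1%:R * g (n - i).+1).
  transitivity (\sum_(i < n.+2) i%:R * f i * g (n.+1 - i)%N +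
                \sum_(i < n.+2) f i * ((n.+1 - i)%:R * g (n.+1 - i)%N)).
    rewrite /fps_mul mulr_sumr -big_split; apply: eq_bigr => i _ /=.
    by rewrite -{1}(subnKC (ltnSE (ltn_ord i))) natrD; ring.
  (* Each sum has one term of weight zero: the first at [i = 0], the second at [i = n.+1]. *)
  congr (_ + _); first by rewrite big_ord_recl !mul0r add0r.
  rewrite big_ord_recr /= subnn mul0r mulr0 addr0.
  by apply: eq_bigr => i _; rewrite subSn // -ltnS.
have eulerM : n%:R * fps_mul f g n =
    \sum_(i < n.+1) i%:R * f i * g (n - i)%N +
    \sum_(i < n.+1) f i * ((n - i)%:R * g (n - i)%N).
  rewrite /fps_mul mulr_sumr -big_split; apply: eq_bigr => i _ /=.
  by rewrite -{1}(subnKC (ltnSE (ltn_ord i))) natrD; ring.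
rewrite {1}/fps_twderiv derivM eulerM mulrDr addrACA.
by congr (_ + _); rewrite mulr_sumr -big_split; apply: eq_bigr => i _ /=;
  rewrite /fps_twderiv; ring.
Qed.

Lemma fps_twderiv_exp f k n : fps_twderiv f =1 fps_scale lambda (@fps1 K) ->
  fps_twderiv (fps_exp f k) n = lambda * k%:R * fps_exp f k.-1 n.
Proof.
move=> Tf; elim: k n => [|k IHk] n.
  by case: n => [|n]; rewrite /fps_twderiv /fps_exp /fps1 /=; ring.
rewrite /fps_exp iterS -/(fps_exp _ _) fps_twderivM (eq_fps_mul Tf (frefl _)).
rewrite fps_mulZl /fps_scale fps_mul1 (eq_fps_mul (frefl _) IHk).
rewrite (fps_mulZr _ _ (fps_exp f k.-1)) /fps_scale.
(* At [k = 0] the truncated [k.-1] is harmless, its term carrying the factor [0]; otherwise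
   [f * f^k] is again a power. *)
case: k {IHk} => [|k] /=; first by rewrite /fps_exp /=; ring.
by rewrite -[k.+2%:R]natr1 /fps_exp /=; ring.
Qed.

End FpsDerivation.

Section LogPowers.
Variables (K : numFieldType) (lambda : K).

Let logl := fps_log1p (fps_scale lambda (@fpsX K)).

Lemma fps_log1p_scaleX_coefS n :
  logl n.+1 = (-1) ^+ n / n.+1%:R * lambda ^+ n.+1.
Proof.
rewrite /logl /fps_log1p big_nat_recr // fps_expZ /fps_scale fps_expX eqxx.
rewrite mulr1 big_nat big1 /= ?add0r // => k /andP[_ ltkn].
by rewrite fps_expZ /fps_scale fps_expX gtn_eqF // !mulr0.
Qed.

(** In positive degree [n] the contributions [(-1)^n lambda^(n+1)] of [d/dt] and
    [(-1)^(n-1) lambda^(n+1)] of [lambda t d/dt] cancel. *)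
Lemma fps_twderiv_log1p_scaleX :
  fps_twderiv lambda logl =1 fps_scale lambda (@fps1 K).
Proof.
have natS_neq0 m : m.+1%:R != 0 :> K by rewrite Num.Theory.pnatr_eq0.
case=> [|n]; rewrite /fps_twderiv /fps_scale /fps1.
  by rewrite fps_log1p_scaleX_coefS /= expr1; field.
rewrite !fps_log1p_scaleX_coefS /= !exprS.
by field; rewrite nat1r -natrD !natS_neq0.
Qed.

Lemma fps_exp_log1p_scaleX k m :
  m`!%:R * fps_exp logl k m = k`!%:R * lambda ^+ m * (stirling1 m k)%:~R.
Proof.
elim: m k => [|m IHm] k.
  rewrite fps_exp_coef0 ?[logl _]fps_log1p_coef0 // stirling10.
  by case: k => [|k]; rewrite ?mulr1 ?mulr0.
have := fps_twderiv_exp k m fps_twderiv_log1p_scaleX.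
(* Solved for the coefficient of degree [m.+1], the derivation identity becomes a recurrence in
   [m]. *)
rewrite {1}/fps_twderiv => /(canRL (addrK _)) rec.
have -> : m.+1`!%:R * fps_exp logl k m.+1 =
    lambda * k%:R * (m`!%:R * fps_exp logl k.-1 m)
    - lambda * m%:R * (m`!%:R * fps_exp logl k m).
  by rewrite factS mulnC natrM -mulrA rec; ring.
rewrite !IHm stirling1S rmorphB rmorphM /= mulrz_nat exprS.
case: k {rec} => [|k] /=; first by ring.
by rewrite factS natrM; ring.
Qed.

(** The factor [(k-1)!] is [k!] divided by the [k] of the outer logarithm, and [lambda ^+ (m - k)]
    combines [lambda ^+ m] with [lambda^-1 ^+ k]. *)
Lemma cauchy2_denominator_coef m : lambda != 0 ->
  m`!%:R * fps_log1p (fps_scale lambda^-1 logl) m =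
  \sum_(1 <= k < m.+1)
    (k.-1)`!%:R * (-1) ^+ k.-1 * lambda ^+ (m - k) * (stirling1 m k)%:~R.
Proof.
move=> l0; rewrite /fps_log1p mulr_sumr [LHS]big_nat [RHS]big_nat.
apply: eq_bigr => -[//|k] /andP[_ ltkm].
rewrite fps_expZ /fps_scale succnK.
transitivity ((-1) ^+ k / k.+1%:R * lambda^-1 ^+ k.+1 *
  (m`!%:R * fps_exp logl k.+1 m)); first by ring.
rewrite fps_exp_log1p_scaleX exprVn factS natrM.
rewrite -[in lambda ^+ m](subnK (ltnSE ltkm)) exprD.
have k0 : k.+1%:R != 0 :> K by rewrite Num.Theory.pnatr_eq0.
have lk0 : lambda ^+ k.+1 != 0 by rewrite expf_neq0.
move: k0 lk0; move: k.+1%:R (lambda ^+ k.+1) => a b a0 b0.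
by field; rewrite b0.
Qed.

(** Compare coefficients of [t] in [cauchy2_gfP]: the denominator has constant term [0] and linear
    coefficient [1]. *)
Lemma cauchy2_coef0 : lambda != 0 -> cauchy2 lambda 0 = 1.
Proof.
move=> l0; have := cauchy2_gfP l0 1%N.
rewrite /fps_mul big_ord_recr big_ord1 /= fps_log1p_coef0 mulr0 addr0.
have := cauchy2_denominator_coef 1 l0.
rewrite big_nat1 stirling1S !stirling10 !mul1r => ->.
by rewrite /fpsX !mulr1 /cauchy2 mul1r.
Qed.

Lemma cauchy2_stirling1_sum n : lambda != 0 ->
  \sum_(1 <= m < n.+1) \sum_(1 <= k < m.+1)
    'C(n, m)%:R * cauchy2 lambda (n - m)%N * (k.-1)`!%:R * (-1) ^+ k.-1
      * lambda ^+ (m - k) * (stirling1 m k)%:~R = (n == 1%N)%:R.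
Proof.
move=> l0; set F := fps_log1p (fps_scale lambda^-1 logl).
transitivity (n`!%:R * fps_mul (cauchy2_gf lambda) F n); last first.
  rewrite cauchy2_gfP // /fpsX.
  by case: eqP => [->|_]; rewrite ?mulr1 ?mulr0.
(* Reversal makes [m] the index of [F]; the term [m = 0] then drops out because [F 0 = 0]. *)
rewrite /fps_mul (reindex_inj rev_ord_inj) /= mulr_sumr.
rewrite -(big_mkord xpredT (fun i => n`!%:R *
  (cauchy2_gf lambda (n - i)%N * F (n - (n - i))%N))).
rewrite [RHS]big_nat_recl //= subn0 subnn [F 0%N]fps_log1p_coef0 !mulr0 add0r.
rewrite big_add1 /= [LHS]big_nat [RHS]big_nat.
apply: eq_bigr => m /andP[_ ltmn]; rewrite subKn //.
transitivity ('C(n, m.+1)%:R * cauchy2 lambda (n - m.+1) *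
  (m.+1`!%:R * F m.+1)).
  rewrite cauchy2_denominator_coef // mulr_sumr.
  by apply: eq_bigr => k _; rewrite !mulrA.
by rewrite -(bin_fact ltmn) !natrM /cauchy2; ring.
Qed.

End LogPowers.

Theorem theorem2p4 (R : realType) (lambda : R[i]) (hlambda : lambda != 0) :
  cauchy2 lambda 0%N = 1 /\
  forall n : nat, (1 <= n)%N ->
    \sum_(1 <= m < n.+1) \sum_(1 <= k < m.+1)
      'C(n, m)%:R * cauchy2 lambda (n - m)%N * (k.-1)`!%:R * (-1) ^+ k.-1
        * lambda ^+ (m - k) * (stirling1 m k)%:~R
    = (if n == 1%N then 1 else 0).
Proof.
split=> [|n _]; first exact: cauchy2_coef0.
by rewrite cauchy2_stirling1_sum //; case: eqP.
Qed.
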